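(* Let $\mathcal H,\psi,\mathcal H^\psi,\tau^\psi,V_1,V_2,T,g,\alpha,\mathcal J$ be as in the context (in particular $\|T\|<1$ and $\mathcal J$ is coercive), and let $L,M\ge 1$ be integers. Let $u^{(0)}\in\mathcal H^\psi$ and let $(u^{(n)})_{n\in\mathbb N}$ be produced by the sequential alternating subspace minimization algorithm of the context. Then $(u^{(n)})_{n\in\mathbb N}$ is a sequence in $\mathcal H^\psi$ with the following properties: (i) $\mathcal J(u^{(n)})>\mathcal J(u^{(n+1)})$ for all $n\in\mathbb N$ (unless $u^{(n)}=u^{(n+1)}$); (ii) $\lim_{n\to\infty}\|u^{(n+1)}-u^{(n)}\|_{\mathcal H}=0$; (iii) the sequence $(u^{(n)})_{n\in\mathbb N}$ has subsequences which converge weakly in $\mathcal H$ and in $\mathcal H^\psi$ endowed with the topology $\tau^\psi$; (iv) if additionally $\dim\mathcal H<\infty$, $(u^{(n_k)})_{k\in\mathbb N}$ is a strongly converging subsequence, and $u^{(\infty)}$ is its limit, with $u_i^{(\infty)}:=\pi_{V_i}u^{(\infty)}$, then $u^{(\infty)}$ is a minimizer of $\mathcal J$ whenever one of the following conditions holds: (a) $\psi(u_1^{(\infty)}+\eta_2)+\psi(u_2^{(\infty)}+\eta_1)-\psi(u_1^{(\infty)}+u_2^{(\infty)})\le\psi(\eta_1+\eta_2)$ for all $\eta_i\in V_i$, $i=1,2$; (b) $\psi$ is differentiable at $u^{(\infty)}$ with respect to $V_i$ for one $i\in\{1,2\}$, i.e., there exists $\zeta_i\in(V_i)'$ such that $$\langle\zeta_i,v_i\rangle=\lim_{t\to0}\frac{\psi(u_1^{(\infty)}+u_2^{(\infty)}+tv_i)-\psi(u_1^{(\infty)}+u_2^{(\infty)})}{t}\quad\text{for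 all }v_i\in V_i.$$
   Context: $\mathcal H$ is a real separable Hilbert space. The function $\psi:\mathcal H\to\mathbb R_+\cup\{+\infty\}$ satisfies: $\psi(0)=0$; $\psi(u+v)\le\psi(u)+\psi(v)$ for all $u,v\in\mathcal H$; $\psi(\lambda u)=|\lambda|\psi(u)$ for all $\lambda\in\mathbb R$; and $\psi$ is lower semicontinuous with respect to norm convergence in $\mathcal H$. The set $\mathcal H^\psi=\{u\in\mathcal H:\psi(u)<\infty\}$ is a dense subspace of $\mathcal H$, $\psi|_{\mathcal H^\psi}$ is a seminorm, and $\mathcal H^\psi$ is a Banach space with the norm $\|u\|_{\mathcal H^\psi}=\|u\|_{\mathcal H}+\psi(u)$. There is a further topology $\tau^\psi$ on $\mathcal H^\psi$ such that every bounded sequence in $\mathcal H^\psi$ has a subsequence converging in $\tau^\psi$ to an element of $\mathcal H^\psi$, and $\psi$ is (sequentially) lower semicontinuous with respect to $\tau^\psi$. $V_1,V_2$ are closed, mutually orthogonal subspaces with $\mathcal H=V_1\oplus V_2$; $\pi_{V_i}$ is the orthogonal projection onto $V_i$; $V_i^\psi:=\mathcal H^\psi\cap V_i$. It is assumed that $\pi_{V_i}|_{\mathcal H^\psi}:\mathcal H^\psi\to V_i^\psi$ is well defined and continuous in the norm of $\mathcal H^\psi$, with range $V_i^\psi$ closed in $\mathcal H^\psi$, $i=1,2$. $T:\mathcal H\to\mathcal H$ is a bounded linear operator with $\|T\|<1$, $g\in\mathcal H$, $\alpha>0$, and $$\mathcal J(u)=\|Tu-g\|_{\mathcal H}^2+2\alpha\psi(u).$$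 $\mathcal J$ is assumed coercive in $\mathcal H$: for every $C$ the set $\{u\in\mathcal H:\mathcal J(u)\le C\}$ is bounded in $\mathcal H$. For $u_1\in V_1$, $u_2\in V_2$, $i\in\{1,2\}$ and $a\in V_i$ define the surrogate functional $$\mathcal J_i^s(u_1+u_2,a)=\mathcal J(u_1+u_2)+\|u_i-a\|_{\mathcal H}^2-\|T(u_i-a)\|_{\mathcal H}^2 .$$ Sequential algorithm: given $u^{(0)}\in\mathcal H^\psi$, put $u_1^{(0,L)}=\pi_{V_1}u^{(0)}$, $u_2^{(0,M)}=\pi_{V_2}u^{(0)}$, and for $n\ge0$: - $u_1^{(n+1,0)}=u_1^{(n,L)}$ and $u_1^{(n+1,\ell+1)}=\operatorname{argmin}_{u_1\in V_1}\mathcal J_1^s(u_1+u_2^{(n,M)},u_1^{(n+1,\ell)})$ for $\ell=0,\dots,L-1$; - $u_2^{(n+1,0)}=u_2^{(n,M)}$ and $u_2^{(n+1,m+1)}=\operatorname{argmin}_{u_2\in V_2}\mathcal J_2^s(u_1^{(n+1,L)}+u_2,u_2^{(n+1,m)})$ for $m=0,\dots,M-1$; - $u^{(n+1)}=u_1^{(n+1,L)}+u_2^{(n+1,M)}$. *)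

(* Defs.v *)
From HB Require Import structures.
From mathcomp Require Import all_boot all_order all_algebra.
From mathcomp Require Import sesquilinear.
From mathcomp Require Import all_classical all_reals all_analysis.

Set Implicit Arguments.
Unset Strict Implicit.
Unset Printing Implicit Defensive.

Import Order.TTheory GRing.Theory Num.Theory.
Import numFieldNormedType.Exports.

Local Open Scope classical_set_scope.
Local Open Scope ring_scope.

Section Hilbert.
Context {R : realType} {H : completeNormedModType R}.
Implicit Types (ip : {dot H for idfun}) (V : set H) (u v w : H).

(* With the completeness of H, this makes H a real Hilbert space. *)
Definition norm_of_dot ip := forall u, ip u u = `|u| ^+ 2.

Definition separable := exists2 D : set H, countable D & dense D.

Definition finite_dimensional :=
  exists (d : nat) (b : 'I_d -> H),
    forall u, exists c : 'I_d -> R, u = \sum_(i < d) c i *: b i.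

Definition closed_subspace V := submod_closed [in V] /\ closed V.

Definition orthogonal_subspaces ip (V1 V2 : set H) :=
  forall v1 v2, V1 v1 -> V2 v2 -> ip v1 v2 = 0.

Definition spanned_by_sum (V1 V2 : set H) :=
  forall u, exists v1 v2, [/\ V1 v1, V2 v2 & u = v1 + v2].

(* For V closed, the set below is a singleton by the projection theorem, so
   the default value 0 is never used. *)
Definition orth_proj ip V u : H :=
  xget 0 [set v | V v /\ forall w, V w -> ip (u - v) w = 0].

(* The values of z outside V are irrelevant. *)
Definition dual_on V (z : H -> R) :=
  (forall (a : R) v w, V v -> V w -> z (a *: v + w) = a * z v + z w) /\
  {within V, continuous z}.

Definition weak_cvg (v : nat -> H) (w : H) :=
  forall f : {linear H -> R^o}, continuous f ->
    f (v n) @[n --> \oo] --> f w.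

(* Meaningful for bounded T only: sup is 0 on sets without upper bound. *)
Definition opnorm (T : H -> H) : R :=
  sup [set `|T u| | u in [set u | `|u| <= 1]].

Definition argmin V (F : H -> \bar R) : set H :=
  [set x | V x /\ forall y, V y -> (F x <= F y)%E].

End Hilbert.

Arguments separable {R} H.
Arguments finite_dimensional {R} H.

Section Functional.
Context {R : realType} {H : completeNormedModType R}.
Variable psi : H -> \bar R.
Implicit Types (u v w : H).

Definition extended_seminorm :=
  [/\ forall u, (0 <= psi u)%E,
      psi 0 = 0%E,
      forall u v, (psi (u + v)%R <= psi u + psi v)%E &
      forall (a : R) u, psi (a *: u) = (`|a|%:E * psi u)%E].

Definition Hpsi : set H := [set u | (psi u < +oo)%E].

Definition Hpsi_norm u : R := `|u| + fine (psi u).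

Definition Hpsi_cvg (v : nat -> H) (w : H) :=
  Hpsi_norm (v n - w) @[n --> \oo] --> (0 : R).

Definition Hpsi_complete :=
  forall v : nat -> H, (forall n, Hpsi (v n)) ->
    (forall e : R, 0 < e -> exists N : nat, forall m n,
        (N <= m)%N -> (N <= n)%N -> Hpsi_norm (v m - v n) < e) ->
    exists2 w, Hpsi w & Hpsi_cvg v w.

Definition Hpsi_continuous (f : H -> H) :=
  forall u, Hpsi u -> forall e : R, 0 < e ->
    exists2 d : R, 0 < d &
      forall v, Hpsi v -> Hpsi_norm (v - u) < d -> Hpsi_norm (f v - f u) < e.

Definition Hpsi_closed (A : set H) :=
  forall u, Hpsi u ->
    (forall e : R, 0 < e -> exists2 v, A v & Hpsi_norm (v - u) < e) -> A u.

Definition compatible_projection (ip : {dot H for idfun}) (V : set H) :=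
  let p := orth_proj ip V in
  [/\ forall u, Hpsi u -> Hpsi (p u),
      Hpsi_continuous p,
      p @` Hpsi = Hpsi `&` V &
      Hpsi_closed (Hpsi `&` V)].

(* The points of Hpsi as a type, to be equipped with the second topology. *)
Definition Hpsi_type : Type := {u : H | (psi u < +oo)%E}.

Definition tau_cvg (tau : Topological.axioms_ Hpsi_type)
    (v : nat -> Hpsi_type) (w : Hpsi_type) :=
  v @ \oo --> (w : Topological.Pack tau).

Definition tau_sequentially_compact (tau : Topological.axioms_ Hpsi_type) :=
  forall v : nat -> Hpsi_type,
    (exists C : R, forall n, Hpsi_norm (\val (v n)) <= C) ->
    exists2 phi : nat -> nat, increasing_seq phi &
      exists w : Hpsi_type, tau_cvg tau (v \o phi) w.

Definition tau_sequentially_lsc (tau : Topological.axioms_ Hpsi_type) :=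
  forall (v : nat -> Hpsi_type) (w : Hpsi_type), tau_cvg tau v w ->
    (psi (\val w) <= limn_einf (fun n => psi (\val (v n))))%E.

Variables (T : H -> H) (g : H) (alpha : R).

Definition energy u : \bar R :=
  ((`|T u - g| ^+ 2)%:E + (2 * alpha)%:E * psi u)%E.

Definition coercive :=
  forall C : R, bounded_set [set u | (energy u <= C%:E)%E].

Definition surrogate1 u1 u2 (a : H) : \bar R :=
  (energy (u1 + u2)%R + (`|u1 - a| ^+ 2 - `|T (u1 - a)| ^+ 2)%:E)%E.

Definition surrogate2 u1 u2 (a : H) : \bar R :=
  (energy (u1 + u2)%R + (`|u2 - a| ^+ 2 - `|T (u2 - a)| ^+ 2)%:E)%E.

(* u1 n l and u2 n m stand for the inner iterates u_1^(n,l) and u_2^(n,m);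
   for n = 0 only u1 0 L and u2 0 M are used. *)
Record sequential_algorithm (ip : {dot H for idfun}) (V1 V2 : set H)
    (L M : nat) (u0 : H) (u : nat -> H) (u1 u2 : nat -> nat -> H) : Prop := {
  init : u 0%N = u0;
  init1 : u1 0%N L = orth_proj ip V1 u0;
  init2 : u2 0%N M = orth_proj ip V2 u0;
  start1 : forall n, u1 n.+1 0%N = u1 n L;
  step1 : forall n l, (l < L)%N ->
    argmin V1 (fun v => surrogate1 v (u2 n M) (u1 n.+1 l)) (u1 n.+1 l.+1);
  start2 : forall n, u2 n.+1 0%N = u2 n M;
  step2 : forall n m, (m < M)%N ->
    argmin V2 (fun v => surrogate2 (u1 n.+1 L) v (u2 n.+1 m)) (u2 n.+1 m.+1);
  update : forall n, u n.+1 = u1 n.+1 L + u2 n.+1 M }.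

Definition splitting_condition (V1 V2 : set H) (w1 w2 : H) :=
  forall eta1 eta2, V1 eta1 -> V2 eta2 ->
    (psi (w1 + eta2)%R + psi (w2 + eta1)%R - psi (w1 + w2)%R
       <= psi (eta1 + eta2)%R)%E.

Definition differentiable_wrt (V : set H) (w : H) :=
  exists2 z : H -> R, dual_on V z &
    forall v, V v ->
      ((psi (w + t *: v)%R - psi w) * (t^-1)%:E)%E @[t --> 0^'] --> (z v)%:E.

End Functional.

(* Main.v *)
Require Import Defs.
From HB Require Import structures.
From mathcomp Require Import all_boot all_order all_algebra.
From mathcomp Require Import sesquilinear.
From mathcomp Require Import all_classical all_reals all_analysis.
From mathcomp Require Import ring lra zify.

Set Implicit Arguments.
Unset Strict Implicit.
Unset Printing Implicit Defensive.

Import Order.TTheory GRing.Theory Num.Theory.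
Import numFieldNormedType.Exports.

Local Open Scope classical_set_scope.
Local Open Scope ring_scope.

(* One surrogate step from [a] to [a'] lowers the energy by at least
   [c * `|a' - a| ^+ 2] with [c = 1 - opnorm T ^+ 2], because the surrogate term
   vanishes at [a].  The energy therefore decreases along the iterates and all
   increments tend to 0; coercivity bounds the iterates, whence the weakly and
   tau-convergent subsequences.  In finite dimension psi is finite and
   continuous, so the minimality of the surrogate steps passes to the limit [w]
   of a subsequence: [J w <= J (w + v) + `|v| ^+ 2] for [v] in V1 or in V2.
   By convexity the quadratic term can be dropped at first order, which leaves
   the variational inequality
     [0 <= <T w - g, T v> + alpha * (psi (w + v) - psi w)]   on V1 and on V2,
   and each of the conditions (a), (b) extends it from V1 and V2 to the whole
   space, where it characterises the minimizers of the convex functional J. *)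

(** * Hilbert spaces *)

Lemma sqr_normD_le {R : realType} {V : normedModType R} (x y : V) :
  `|x + y| ^+ 2 <= 2 * `|x| ^+ 2 + 2 * `|y| ^+ 2.
Proof.
have := ler_normD x y; have := sqr_ge0 (`|x| - `|y|).
have := normr_ge0 (x + y).
move: `|x + y| `|x| `|y| => z a b; nra.
Qed.

Section InnerProduct.
Context {R : realType} {H : completeNormedModType R} (ip : {dot H for idfun}).
Context (ipE : norm_of_dot ip).
Implicit Types (x y z : H) (a : R).

Lemma dotC x y : ip x y = ip y x.
Proof. by rewrite hermC expr0 mul1r. Qed.

Lemma dotDl x y z : ip (x + y) z = ip x z + ip y z.
Proof. exact: linearDl. Qed.

Lemma dotDr x y z : ip z (x + y) = ip z x + ip z y.
Proof. exact: linearDr. Qed.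

Lemma dotZl a x z : ip (a *: x) z = a * ip x z.
Proof. exact: linearZl_LR. Qed.

Lemma dotZr a x z : ip z (a *: x) = a * ip z x.
Proof. exact: linearZr_LR. Qed.

Lemma dotNl x z : ip (- x) z = - ip x z.
Proof. exact: linearNl. Qed.

Lemma dotNr x z : ip z (- x) = - ip z x.
Proof. exact: linearNr. Qed.

Lemma dot_suml I (r : seq I) (P : pred I) (F : I -> H) z :
  ip (\sum_(i <- r | P i) F i) z = \sum_(i <- r | P i) ip (F i) z.
Proof. exact: linear_sumlz. Qed.

Lemma sqr_normD x y : `|x + y| ^+ 2 = `|x| ^+ 2 + 2 * ip x y + `|y| ^+ 2.
Proof. by rewrite -!ipE dotDl !dotDr (dotC y x); ring. Qed.

Lemma sqr_normB x y : `|x - y| ^+ 2 = `|x| ^+ 2 - 2 * ip x y + `|y| ^+ 2.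
Proof. by rewrite sqr_normD dotNr normrN; ring. Qed.

Lemma sqr_normZ a x : `|a *: x| ^+ 2 = a ^+ 2 * `|x| ^+ 2.
Proof. by rewrite normrZ exprMn real_normK ?num_real. Qed.

(** Cauchy-Schwarz: the vector whose square is expanded is |y|^2 times the component of [x]
    orthogonal to [y]. *)
Lemma dot_le x y : `|ip x y| <= `|x| * `|y|.
Proof.
have [->|y0] := eqVneq y 0; first by rewrite linear0r !normr0 mulr0.
have y2 : 0 < `|y| ^+ 2 by rewrite exprn_gt0 // normr_gt0.
have : 0 <= `|(`|y| ^+ 2) *: x - ip x y *: y| ^+ 2 by rewrite sqr_ge0.
rewrite sqr_normB !sqr_normZ dotZl dotZr.
rewrite (_ : _ + _ = `|y| ^+ 2 * ((`|x| * `|y|) ^+ 2 - ip x y ^+ 2)); last by ring.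
rewrite pmulr_rge0 // subr_ge0 -(real_normK (num_real (ip x y))) ler_sqr ?nnegrE ?mulr_ge0 //.
Qed.

Section Riesz.
Context (f : H -> R) (C : R).
Context (fL : forall a x y, f (a *: x + y) = a * f x + f y).
Context (fC : forall x, `|f x| <= C * `|x|).

(** Up to an additive constant this is |x - w|^2 for the representative [w] that is sought. *)
Let E x := `|x| ^+ 2 - 2 * f x.

(** Direct method: [E] is bounded below, its minimizing sequences are Cauchy, and stationarity at
    the minimizer is the representation. *)
Lemma riesz : exists w, forall x, f x = ip w x.
Proof.
have f0 : f 0 = 0.
  by apply/eqP; rewrite -normr_le0 (le_trans (fC 0)) // normr0 mulr0.
have fD x y : f (x + y) = f x + f y by rewrite -[x]scale1r fL mul1r scale1r.
have fZ a x : f (a *: x) = a * f x by rewrite -[_ *: _]addr0 fL f0 addr0.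
have fN x : f (- x) = - f x by rewrite -scaleN1r fZ mulN1r.
have Elb x : - C ^+ 2 <= E x.
  have := fC x; rewrite ler_norml => /andP[_ h].
  have := sqr_ge0 (`|x| - C); rewrite /E; nra.
pose m := inf (range E).
have hE : has_inf (range E).
  by split; [exists (E 0), 0|exists (- C ^+ 2) => _ [x _ <-]].
have mE x : m <= E x by apply: ge_inf; [case: hE|exists x].
(* Parallelogram law: the left side is 2 E(x) + 2 E(y) - 4 E((x + y)/2), and the midpoint has [E] at
   least [m]. *)
have par x y : `|x - y| ^+ 2 <= 2 * (E x - m) + 2 * (E y - m).
  have := mE ((2^-1 : R) *: (x + y)).
  rewrite {1}/E sqr_normZ fZ fD sqr_normD sqr_normB /E; lra.
have /choice[x_ xE] : forall n : nat, exists x, E x < m + n.+1%:R^-1.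
  move=> n; have [|_ [x _ <-] h] := @inf_adherent _ _ (n.+1%:R^-1 : R) _ hE.
    by rewrite invr_gt0.
  by exists x.
have xc : cvgn x_.
  apply/cauchy_cvgP/cauchy_exP => e e0.
  pose N := Num.truncn (4 / e ^+ 2).
  have hN k : (N <= k)%N -> 4 / k.+1%:R < e ^+ 2.
    move=> Nk; rewrite ltr_pdivrMr // mulrC -ltr_pdivrMr ?exprn_gt0 //.
    apply: lt_le_trans (truncnS_gt _) _; by rewrite ler_nat ltnS.
  exists (x_ N); exists N => // k /= Nk; rewrite -ball_normE /=.
  rewrite -ltr_sqr ?nnegrE ?normr_ge0 ?(ltW e0) //.
  apply: le_lt_trans (par _ _) _.
  have := xE N; have := xE k; have := hN N (leqnn N); have := hN k Nk.
  move: (E _) (E _) (e ^+ 2) (_^-1) (_^-1) => a b c d d'; lra.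
pose w := limn x_.
have Ew x : E w <= E x.
  apply: (le_trans _ (mE x)).
  have fc : f (x_ n) @[n --> \oo] --> f w.
    apply/cvgrPdist_le => e e0.
    have C1 : 0 < `|C| + 1 by rewrite ltr_wpDl.
    have /cvgrPdist_le/(_ (e / (`|C| + 1))) := xc.
    rewrite divr_gt0 // => /(_ isT); apply: filterS => n h.
    rewrite -fN -fD (le_trans (fC _)) //.
    move: h; rewrite ler_pdivlMr // => h; apply: le_trans h.
    rewrite mulrC ler_wpM2l // (le_trans (ler_norm C)) //; lra.
  have Ec : E (x_ n) @[n --> \oo] --> E w.
    apply: cvgB; last by apply: cvgM fc; exact: cvg_cst.
    by apply: (@cvgM _ _ _ _ (fun n => `|x_ n|) (fun n => `|x_ n|)); apply: cvg_norm.
  have mc : m + n.+1%:R^-1 @[n --> \oo] --> m.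
    rewrite -[X in _ --> X]addr0; apply: cvgD; first exact: cvg_cst.
    exact: cvg_harmonic.
  apply: (ler_cvg_to Ec mc); apply: nearW => n; exact/ltW/xE.
exists w => x; apply/eqP; rewrite -subr_eq0 -sqrf_eq0 -[_ == 0]negbK.
apply/negP => d0.
have d2 : 0 < (f x - ip w x) ^+ 2 by rewrite lt_neqAle eq_sym d0 sqr_ge0.
(* With [d] the defect f(x) - <w, x>, moving from [w] by q d x changes [E] by q d^2 (q |x|^2 - 2),
   which is negative since q |x|^2 < 1. *)
pose q : R := (`|x| ^+ 2 + 1)^-1.
have q0 : 0 < q by rewrite invr_gt0 ltr_wpDl ?sqr_ge0.
have q1 : q * (`|x| ^+ 2 + 1) = 1 by rewrite mulVf // gt_eqF // -invr_gt0.
pose d := f x - ip w x.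
have := Ew (w + (q * d) *: x).
rewrite /E sqr_normD sqr_normZ fD fZ dotZr => h.
have : 0 <= q * d ^+ 2 * (q * `|x| ^+ 2 - 2).
  move: h; rewrite -subr_ge0 => /le_trans; apply; rewrite le_eqVlt.
  by apply/orP; left; apply/eqP; rewrite /d; ring.
rewrite (pmulr_rge0 _ (mulr_gt0 q0 d2)) => h2; move: q1; rewrite mulrDr mulr1 => q1; lra.
Qed.

End Riesz.
End InnerProduct.

(** * Weak compactness *)

(** Compactness of [-K, K] gives the image filter a cluster point, and an ultrafilter converges to
    each of its cluster points. *)
Lemma ultra_bounded_cvg {R : realType} {I : Type} (G : set_system I)
    (GU : UltraFilter G) (f : I -> R) (K : R) :
  (forall i, `|f i| <= K) -> exists l : R, f i @[i --> G] --> l.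
Proof.
move=> fK; have : ProperFilter (f @ G) by apply: fmap_proper_filter.
move=> /(@segment_compact _ (- K) K (f @ G))[|l [_ lc]].
  by apply: (@filterE _ G) => i; rewrite /= in_itv /= -ler_norml.
exists l; apply/cvgrPdist_lt => e e0.
have [//|Ge] := in_ultra_setVsetC [set i | `|l - f i| < e] GU.
have GA : (f @ G) (f @` (~` [set i | `|l - f i| < e])).
  by apply: (@filterS _ G _ _ _ _ Ge) => i Gi; exists i.
have [_ [[i /= Gi <-]]] := lc _ (ball l e) GA (nbhsx_ballx _ _ e0).
by rewrite -ball_normE.
Qed.

Section WeakCompactness.
Context {R : realType} {H : completeNormedModType R} (ip : {dot H for idfun}).
Context (ipE : norm_of_dot ip).

(** By Riesz, every continuous functional is the inner product with a fixed vector. *)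
Lemma weak_cvgP (v : nat -> H) (w : H) :
  (forall h, ip (v n) h @[n --> \oo] --> ip w h) -> weak_cvg v w.
Proof.
move=> vw f fc.
have [C fC] : exists C, forall x, `|f x| <= C * `|x|.
  have /linear_boundedP : bounded_near f (nbhs (0 : H)).
    exact/linear_bounded_continuous.
  by move=> /pinfty_ex_gt0[C _ fC]; exists C.
have [||z fz] := @riesz _ _ ip ipE f C; first by move=> a x y; rewrite linearP.
  by [].
under eq_fun do rewrite fz (dotC ip); rewrite fz (dotC ip); exact: vw.
Qed.

(* An ultrafilter on the indices gives a limit of [ip (x n) h] for every [h]
   at once; separability is only used to return to a subsequence. *)
Lemma weakly_convergent_subsequence (x : nat -> H) (C : R) :
  separable H -> (forall n, `|x n| <= C) ->
  exists2 phi : nat -> nat, increasing_seq phi &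
    exists w, weak_cvg (x \o phi) w.
Proof.
move=> [D /countable_injP[idx idx_inj] Dd] xC.
have [G [GU ooG]] := ultraFilterLemma (@eventually_filter).
have ip_le h n : `|ip (x n) h| <= C * `|h|.
  by apply: (le_trans (dot_le ipE _ _)); rewrite ler_wpM2r.
have /choice[l lE] h : exists l : R, ip (x n) h @[n --> G] --> l.
  exact: (@ultra_bounded_cvg _ _ _ _ (fun n => ip (x n) h) (C * `|h|)).
(* The limits along [G] are linear in [h] and bounded by C |h|; the vector representing them is the
   candidate weak limit. *)
have [|h|w wE] := @riesz _ _ ip ipE l C.
- move=> a h k; apply: (@cvg_unique _ _ (ip (x n) (a *: h + k) @[n --> G])).
    exact: norm_hausdorff.
    exact: lE.
  rewrite (_ : (fun n => _) = fun n => a * ip (x n) h + ip (x n) k).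
    2: by apply/funext => n; rewrite dotDr dotZr.
  by apply: cvgD => //; apply: cvgM => //; exact: cvg_cst.
- apply: (cvgr_to_le (cvg_norm (lE h))); exact: filterE.
(* As [idx] is injective, only finitely many points of [D] have index below [k], so finitely many
   sets of [G] are intersected; the induction on [m] adds one index at a time at a fixed
   tolerance. *)
have approx k : G [set n | forall d, D d -> (idx d < k)%N ->
    `|l d - ip (x n) d| < k.+1%:R^-1].
  suff : forall m, (m <= k)%N -> G [set n | forall d, D d -> (idx d < m)%N ->
    `|l d - ip (x n) d| < k.+1%:R^-1] by apply.
  elim=> [_|m IH mk]; first exact: filterE.
  have [[d [Dd' dm]]|nod] := pselect (exists d, D d /\ idx d = m); last first.
    apply: filterS (IH (ltnW mk)) => n nP d Dd' /=.
    rewrite ltnS leq_eqVlt => /orP[/eqP dm|]; last exact: nP.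
    by case: nod; exists d.
  have Gd : G [set n | `|l d - ip (x n) d| < k.+1%:R^-1].
    by move/cvgrPdist_lt : (lE d); apply; rewrite invr_gt0.
  apply: filterS (filterI (IH (ltnW mk)) Gd) => n [nP /= nd] e De.
  rewrite ltnS leq_eqVlt => /orP[/eqP em|]; last exact: nP.
  by rewrite (idx_inj e d) ?inE // em dm.
have /choice[next nextP] : forall p : nat * nat, exists n, (p.2 < n)%N /\
    forall d, D d -> (idx d < p.1)%N -> `|l d - ip (x n) d| < p.1.+1%:R^-1.
  move=> [k N]; have GN : G [set n | (N < n)%N] by apply: ooG; exists N.+1.
  by have [n [nP Nn]] := filter_ex (filterI (approx k) GN); exists n.
(* Stage [k] controls the points of index below [k] up to 1/(k+1) and lies beyond the previous
   stage; stage 0 controls no point. *)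
pose phi := fix phi k := if k is k'.+1 then next (k, phi k') else next (0, 0).
have phiP k d : D d -> (idx d < k)%N -> `|l d - ip (x (phi k)) d| < k.+1%:R^-1.
  by case: k => // k; apply: (nextP (k.+1, phi k)).2.
exists phi; first by apply/increasing_seqP => k; exact: (nextP (k.+1, phi k)).1.
exists w; apply: weak_cvgP => h; apply/cvgrPdist_lt => e e0.
have C0 : 0 <= C by apply: le_trans (xC 0).
(* [K] bounds every w - x(n), so replacing [h] by a point of [D] within e/(2K) costs at most e/2;
   [phiP] accounts for the other half. *)
pose K := C + `|w| + 1.
have K0 : 0 < K by rewrite /K ltr_wpDl // addr_ge0.
have [|d [hd Dd']] := Dd (ball h (e / 2 / K)) _ (@ball_open _ _ _ _).
  by exists h; apply: ballxx; rewrite !divr_gt0.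
exists (maxn (idx d).+1 (Num.truncn (2 / e)).+1) => // k /=.
rewrite geq_max => /andP[dk ek].
have := phiP k d Dd' dk; rewrite wE => h1.
have h2 : k.+1%:R^-1 < e / 2.
  rewrite -[e / 2]invrK ltf_pV2 ?posrE ?invr_gt0 ?divr_gt0 // invf_div.
  by apply: (lt_le_trans (truncnS_gt _)); rewrite ler_nat (leq_trans ek).
have h3 : `|ip (w - x (phi k)) (h - d)| <= e / 2.
  apply: (le_trans (dot_le ipE _ _)).
  apply: (@le_trans _ _ (K * (e / 2 / K))); last by rewrite mulrC divfK // gt_eqF.
  apply: ler_pM => //; last by rewrite ltW //; move: hd; rewrite -ball_normE.
  by apply: (le_trans (ler_normB _ _)); have := xC (phi k); rewrite /K; lra.
rewrite (_ : _ - _ = (ip w d - ip (x (phi k)) d) + ip (w - x (phi k)) (h - d)).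
  by apply: (le_lt_trans (ler_normD _ _)); move: h1 h2 h3; move: (k.+1%:R^-1) => r; lra.
by rewrite dotDl dotNl !dotDr !dotNr /=; ring.
Qed.

End WeakCompactness.

(** * Finite dimension *)

Section FiniteDimension.
Context {R : realType} {H : completeNormedModType R} (ip : {dot H for idfun}).
Context (ipE : norm_of_dot ip).

(** Indexing by [nat] with a cutoff [k] lets a family be extended by one vector without changing its
    type. *)
Definition orthonormal_family (k : nat) (e : nat -> H) :=
  forall i j, (i < k)%N -> (j < k)%N -> ip (e i) (e j) = (i == j)%:R.

Let proj k (e : nat -> H) x := \sum_(i < k) ip x (e i) *: e i.

(* The Gram matrix of the family factors as [A *m G *m A^T] through the
   spanning family. *)
Lemma orthonormal_family_size (d : nat) (b : 'I_d -> H) (k : nat) (e : nat -> H) :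
  (forall u, exists c : 'I_d -> R, u = \sum_(i < d) c i *: b i) ->
  orthonormal_family k e -> (k <= d)%N.
Proof.
move=> bspan eon; have /choice[c cE] := fun i => bspan (e i).
pose A : 'M[R]_(k, d) := \matrix_(i, j) c i j.
pose G : 'M[R]_d := \matrix_(i, j) ip (b i) (b j).
have AGA : A *m G *m A^T = 1%:M.
  apply/matrixP => i j; rewrite !mxE -[RHS]/((i == j :> nat)%:R) -eon //.
  rewrite [in RHS](cE j) linear_sumr /=; apply: eq_bigr => l _.
  rewrite dotZr [RHS]mulrC !mxE; congr (_ * _).
  rewrite (cE i) dot_suml; apply: eq_bigr => m _.
  by rewrite !mxE dotZl.
have := mxrankM_maxl A (G *m A^T).
by rewrite mulmxA AGA mxrank1 => /leq_trans; apply; exact: rank_leq_col.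
Qed.

Lemma orthonormal_family_proj k e x i : orthonormal_family k e ->
  (i < k)%N -> ip (x - proj k e x) (e i) = 0.
Proof.
move=> eon ik; rewrite dotDl dotNl dot_suml (bigD1 (Ordinal ik)) //=.
rewrite dotZl eon // eqxx mulr1 big1 ?addr0 ?subrr // => j ji.
by rewrite dotZl eon // (_ : (_ == _) = false) ?mulr0 //; apply/negbTE: ji.
Qed.

(** An orthonormal family in [D] of maximal size spans [D], and density extends this to the whole
    space. Having the vectors inside [D] is the point: for [D] the domain of [psi], the penalty is
    finite on them. *)
Lemma dense_subspace_orthonormal_basis (D : set H) :
  finite_dimensional H -> D 0 ->
  (forall (a : R) x y, D x -> D y -> D (a *: x + y)) -> dense D ->
  exists k e, (forall i, (i < k)%N -> D (e i)) /\
    forall x, x = \sum_(i < k) ip x (e i) *: e i.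
Proof.
move=> [d [b bspan]] D0 DP Ddense.
pose P k := `[< exists2 e, orthonormal_family k e &
  forall i, (i < k)%N -> D (e i) >].
have Pd k : P k -> (k <= d)%N.
  by move=> /asboolP[e eon _]; exact: orthonormal_family_size eon.
have P0 : exists k, P k by exists 0%N; apply/asboolP; exists (fun=> 0).
case: (ex_maxnP P0 Pd) => k /asboolP[e eon eD] kmax.
have Dproj x : D (proj k e x).
  rewrite /proj; elim/big_ind: _ => // [x1 x2 D1 D2|i _].
    by rewrite -[x1]scale1r; exact: DP.
  by rewrite -[_ *: _]addr0; apply: DP => //; exact: eD.
have Dspan x : D x -> x = proj k e x.
  move=> Dx; apply/eqP; rewrite -subr_eq0; apply/negP => /negP r0.
  pose r := x - proj k e x; pose q := `|r|^-1 *: r.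
  have Dr : D r by rewrite /r addrC -scaleN1r; exact: DP.
  have re i : (i < k)%N -> ip q (e i) = 0.
    by move=> ik; rewrite dotZl orthonormal_family_proj ?mulr0.
  have qq : ip q q = 1 by rewrite ipE sqr_normZ exprVn mulVf // expf_eq0 normr_eq0.
  have : P k.+1; last by move/kmax; rewrite ltnn.
  apply/asboolP; exists (fun i => if (i < k)%N then e i else q).
    move=> i j; rewrite !ltnS => ik jk; case: ltnP => ik'; case: ltnP => jk'.
    - exact: eon.
    - by rewrite dotC re // ltn_eqF // (leq_trans ik').
    - by rewrite re // gtn_eqF // (leq_trans jk').
    - by rewrite qq (_ : i = j) ?eqxx //; apply/eqP; rewrite eqn_leq; lia.
  move=> i _; case: ifP => [ik|_]; first exact: eD.
  by rewrite /q -[_ *: _]addr0; apply: DP.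
exists k, e; split=> // x; apply/eqP; rewrite -subr_eq0; apply/negP => /negP r0.
pose r := x - proj k e x.
have n0 : 0 < `|r| by rewrite normr_gt0.
(* The residual [r] is orthogonal to the span, so by Pythagoras no point of the span, hence none of
   [D], lies at distance less than |r| from [r]. *)
have [|y [ry /Dspan yE]] := Ddense (ball r `|r|) _ (@ball_open _ _ _ _).
  by exists r; exact: ballxx.
have ry0 : ip r y = 0.
  rewrite yE linear_sumr big1 // => i _ /=.
  by rewrite dotZr orthonormal_family_proj ?mulr0.
move: ry; rewrite -ball_normE /= -ltr_sqr ?nnegrE // (sqr_normB ipE) ry0.
have := sqr_ge0 `|y|; lra.
Qed.

End FiniteDimension.

(** * Descent of the surrogate iteration *)

Section OrthogonalProjection.
Context {R : realType} {H : completeNormedModType R} (ip : {dot H for idfun}).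
Context (ipE : norm_of_dot ip).

(** Uniqueness: the residuals of two candidates are orthogonal to both candidates, so the difference
    of the candidates is orthogonal to itself. *)
Lemma orth_projE (V : set H) (u v : H) :
  V v -> (forall w, V w -> ip (u - v) w = 0) -> orth_proj ip V u = v.
Proof.
move=> Vv uv; apply: xget_unique; first by split.
move=> w [Vw uw]; apply/eqP; rewrite -subr_eq0 -normr_eq0 -sqrf_eq0 -ipE.
rewrite {1}(_ : w - v = (u - v) - (u - w)); last first.
  by rewrite opprB [RHS]addrC addrA subrK.
by rewrite dotDl !(dotDr, dotNl, dotNr) !uv // !uw // !(oppr0, addr0).
Qed.

Context (V1 V2 : set H) (V12 : orthogonal_subspaces ip V1 V2).

Lemma orth_projDl (v1 v2 : H) : V1 v1 -> V2 v2 ->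
  orth_proj ip V1 (v1 + v2) = v1.
Proof.
move=> Vv1 Vv2; apply: orth_projE => // w Vw.
by rewrite addrC addKr dotC V12.
Qed.

Lemma orth_projDr (v1 v2 : H) : V1 v1 -> V2 v2 ->
  orth_proj ip V2 (v1 + v2) = v2.
Proof. by move=> Vv1 Vv2; apply: orth_projE => // w Vw; rewrite addrK V12. Qed.

End OrthogonalProjection.

Section Contraction.
Context {R : realType} {H : completeNormedModType R} (T : {linear H -> H}).
Context (T_bounded : bounded_fun_norm T) (T_lt1 : opnorm T < 1).

(** [T_bounded] provides the upper bound that makes the [sup] in [opnorm] a genuine supremum. *)
Lemma le_opnorm_ball x : `|x| <= 1 -> `|T x| <= opnorm T.
Proof.
move=> x1; apply: ub_le_sup; last by exists x.
by have [K TK] := T_bounded 1; exists K => _ [y y1 <-]; exact: TK.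
Qed.

Lemma opnorm_ge0 : 0 <= opnorm T.
Proof. by apply: le_trans (le_opnorm_ball (x := 0) _); rewrite ?normr0. Qed.

Lemma le_opnorm x : `|T x| <= opnorm T * `|x|.
Proof.
have [->|x0] := eqVneq x 0; first by rewrite linear0 !normr0 mulr0.
have n0 : 0 < `|x| by rewrite normr_gt0.
rewrite -ler_pdivrMr // mulrC -[_^-1]ger0_norm ?invr_ge0 // -normrZ -linearZ.
by apply: le_opnorm_ball; rewrite normrZ ger0_norm ?invr_ge0 // mulVf ?gt_eqF.
Qed.

Lemma contraction_gap :
  exists2 c : R, 0 < c & forall x, c * `|x| ^+ 2 <= `|x| ^+ 2 - `|T x| ^+ 2.
Proof.
have q0 := opnorm_ge0.
exists (1 - opnorm T ^+ 2); first by rewrite subr_gt0 expr_lt1.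
move=> x; rewrite mulrBl mul1r lerD2l lerN2 -exprMn.
by rewrite ler_sqr ?nnegrE ?mulr_ge0 // le_opnorm.
Qed.

Lemma continuous_bounded_operator : continuous T.
Proof.
apply: bounded_linear_continuous; apply/linear_boundedP.
exists (opnorm T); split; first exact: num_real.
move=> r /ltW qr x; apply: (le_trans (le_opnorm x)).
by rewrite ler_wpM2r.
Qed.

End Contraction.

Section Energy.
Context {R : realType} {H : completeNormedModType R}.
Context (psi : H -> \bar R) (psi_seminorm : extended_seminorm psi).
Context (T : {linear H -> H}) (g : H) (alpha : R) (alpha_gt0 : 0 < alpha).

(** It agrees with [energy] only on [Hpsi psi]: elsewhere [fine] turns the value +oo of [psi] into
    0. *)
Definition real_energy u : R := `|T u - g| ^+ 2 + 2 * alpha * fine (psi u).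

Let F := real_energy.

Lemma Hpsi_fin_num u : Hpsi psi u -> psi u \is a fin_num.
Proof.
by move=> pu; rewrite ge0_fin_numE //; case: psi_seminorm.
Qed.

Lemma HpsiD u v : Hpsi psi u -> Hpsi psi v -> Hpsi psi (u + v).
Proof.
move=> pu pv; case: psi_seminorm => _ _ psiD _.
by apply: (le_lt_trans (psiD u v)); exact: lte_add_pinfty.
Qed.

Lemma HpsiZ a u : Hpsi psi u -> Hpsi psi (a *: u).
Proof.
move=> pu; case: psi_seminorm => _ _ _ psiZ.
by rewrite /Hpsi /= psiZ -(fineK (Hpsi_fin_num pu)) -EFinM ltry.
Qed.

Lemma energyE u : Hpsi psi u -> energy psi T g alpha u = (F u)%:E.
Proof.
by move=> pu; rewrite /energy -[psi u]fineK ?Hpsi_fin_num // -EFinM -EFinD.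
Qed.

Lemma energy_pinfty u : ~ Hpsi psi u -> energy psi T g alpha u = +oo%E.
Proof.
move=> /negP; rewrite -leNgt leye_eq => /eqP pu.
by rewrite /energy pu gt0_muley ?lte_fin ?mulr_gt0.
Qed.

Lemma real_energy_ge0 u : 0 <= F u.
Proof.
apply: addr_ge0; first exact: sqr_ge0.
apply: mulr_ge0; first by rewrite mulr_ge0 // ltW.
by apply: fine_ge0; case: psi_seminorm.
Qed.

(** Exchanging the components lets the results on [surrogate1] serve both inner loops. *)
Lemma surrogate2E u1 u2 a :
  surrogate2 psi T g alpha u1 u2 a = surrogate1 psi T g alpha u2 u1 a.
Proof. by rewrite /surrogate1 (addrC u2). Qed.

Lemma surrogate_argmin (V : set H) (a a' b : H) :
  argmin V (fun v => surrogate1 psi T g alpha v b a) a' ->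
  V a -> Hpsi psi (a + b) ->
  [/\ V a', Hpsi psi (a' + b) & forall v, V v -> Hpsi psi (v + b) ->
    F (a' + b) + (`|a' - a| ^+ 2 - `|T (a' - a)| ^+ 2) <=
    F (v + b) + (`|v - a| ^+ 2 - `|T (v - a)| ^+ 2)].
Proof.
move=> [Va' a'min] Va pab.
have pa'b : Hpsi psi (a' + b).
  apply: contrapT => pa'b; have := a'min a Va.
  by rewrite /surrogate1 (energy_pinfty pa'b) (energyE pab) -EFinD addye // leye_eq.
split=> // v Vv pvb; have := a'min v Vv.
by rewrite /surrogate1 !energyE // -!EFinD lee_fin.
Qed.

Context (c : R) (c_gt0 : 0 < c).
Context (T_gap : forall x, c * `|x| ^+ 2 <= `|x| ^+ 2 - `|T x| ^+ 2).

Lemma surrogate_descent (V : set H) (a a' b : H) :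
  argmin V (fun v => surrogate1 psi T g alpha v b a) a' ->
  V a -> Hpsi psi (a + b) -> c * `|a' - a| ^+ 2 <= F (a + b) - F (a' + b).
Proof.
move=> amin Va pab; have [_ _ /(_ a Va pab)] := surrogate_argmin amin Va pab.
by rewrite subrr linear0 normr0 subrr addr0; have := T_gap (a' - a); lra.
Qed.

(** The factor 2^l comes from iterating |x + y|^2 <= 2|x|^2 + 2|y|^2. The first increment is kept
    separately because the optimality of limit points is read off the first inner step. *)
Lemma inner_loop_descent (V : set H) (b : H) (s : nat -> H) (L : nat) :
  (forall l, (l < L)%N ->
    argmin V (fun v => surrogate1 psi T g alpha v b (s l)) (s l.+1)) ->
  V (s 0%N) -> Hpsi psi (s 0%N + b) -> forall l, (l <= L)%N ->
  [/\ V (s l), Hpsi psi (s l + b),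
     c * `|s l - s 0%N| ^+ 2 <= 2 ^+ l * (F (s 0%N + b) - F (s l + b)) &
     (0 < l)%N -> c * `|s 1%N - s 0%N| ^+ 2 <= F (s 0%N + b) - F (s l + b)].
Proof.
move=> smin V0 p0; elim=> [_|l IH lL].
  by rewrite !subrr normr0 expr0n mulr0; split.
have [Vl pl IH1 IH2] := IH (ltnW lL).
have [Vl' pl' _] := surrogate_argmin (smin l lL) Vl pl.
have dl := surrogate_descent (smin l lL) Vl pl.
have cd0 (x : H) : 0 <= c * `|x| ^+ 2 :> R by rewrite mulr_ge0 ?sqr_ge0 // ltW.
split=> //; last first.
  case: l IH IH1 IH2 lL dl {Vl pl Vl' pl'} => [_ _ _ _ dl|l _ _ IH2 _ dl] _ //.
  by have := IH2 isT; have := cd0 (s l.+2 - s l.+1); lra.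
have n2 : c * `|s l.+1 - s 0%N| ^+ 2 <=
    2 * (c * `|s l.+1 - s l| ^+ 2) + 2 * (c * `|s l - s 0%N| ^+ 2).
  rewrite -!(mulrCA c) -mulrDr ler_pM2l //.
  by rewrite -(subrKA (s l)); exact: sqr_normD_le.
have k1 : 1 <= 2 ^+ l :> R by rewrite exprn_ege1 // ler1n.
rewrite (exprS 2 l); apply: (le_trans n2).
(* The new step contributes its energy drop with weight 2, which 2^(l+1) dominates as 2^l >= 1. *)
have := mulr_ge0 (_ : 0 <= 2 ^+ l - 1) (le_trans (cd0 (s l.+1 - s l)) dl).
by rewrite subr_ge0 => /(_ k1); lra.
Qed.

End Energy.

Lemma cvg0_of_sqr_norm_le {R : realType} {H : completeNormedModType R}
    (x : nat -> H) (D : nat -> R) (c K : R) :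
  0 < c -> (forall n, c * `|x n| ^+ 2 <= K * D n) ->
  D n @[n --> \oo] --> (0 : R) -> x n @[n --> \oo] --> (0 : H).
Proof.
move=> c0 xD D0; apply/norm_cvg0P.
have x2 : `|x n| ^+ 2 @[n --> \oo] --> (0 : R).
  apply: (@squeeze_cvgr _ _ _ _ (fun=> 0) (fun n => K / c * D n)).
  - apply: nearW => n; rewrite sqr_ge0 /= mulrAC ler_pdivlMr // mulrC; exact: xD.
  - exact: cvg_cst.
  - by rewrite -(mulr0 (K / c)); apply: cvgM => //; exact: cvg_cst.
have := cvg_comp _ _ x2 (@sqrt_continuous R 0); rewrite sqrtr0.
by rewrite (_ : _ \o _ = fun n => `|x n|) //; apply/funext => n /=;
  rewrite sqrtr_sqr normr_id.
Qed.

Section Algorithm.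
Context {R : realType} {H : completeNormedModType R} (ip : {dot H for idfun}).
Context (ipE : norm_of_dot ip).
Context (psi : H -> \bar R) (psi_seminorm : extended_seminorm psi).
Context (V1 V2 : set H) (V12_orth : orthogonal_subspaces ip V1 V2).
Context (V12_sum : spanned_by_sum V1 V2).
Context (T : {linear H -> H}) (g : H) (alpha : R) (alpha_gt0 : 0 < alpha).
Context (c : R) (c_gt0 : 0 < c).
Context (T_gap : forall x, c * `|x| ^+ 2 <= `|x| ^+ 2 - `|T x| ^+ 2).
Context (L M : nat) (L_ge1 : (1 <= L)%N) (M_ge1 : (1 <= M)%N).
Context (u0 : H) (u0_Hpsi : Hpsi psi u0).
Context (u : nat -> H) (u1 u2 : nat -> nat -> H).
Context (u_alg : sequential_algorithm psi T g alpha ip V1 V2 L M u0 u u1 u2).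

Let F := real_energy psi T g alpha.
Let D n := F (u n) - F (u n.+1).

(** Invariant of the outer loop; at 0 it rests on the two projections of [u0] adding up to [u0]. *)
Definition split_iterate n :=
  [/\ V1 (u1 n L), V2 (u2 n M), u n = u1 n L + u2 n M & Hpsi psi (u n)].

Lemma step2_surrogate1 n m : (m < M)%N ->
  argmin V2 (fun v => surrogate1 psi T g alpha v (u1 n.+1 L) (u2 n.+1 m))
    (u2 n.+1 m.+1).
Proof.
move=> mM; rewrite (_ : (fun v => _) =
  fun v => surrogate2 psi T g alpha (u1 n.+1 L) v (u2 n.+1 m)).
  exact: step2 u_alg _ _ mM.
by apply/funext => v; rewrite surrogate2E.
Qed.

Lemma split_iterate0 : split_iterate 0.
Proof.
have [v1 [v2 [Vv1 Vv2 uE]]] := V12_sum u0.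
rewrite /split_iterate (init u_alg) (init1 u_alg) (init2 u_alg) uE.
by rewrite (orth_projDl ipE V12_orth) // (orth_projDr ipE V12_orth) // -uE.
Qed.

(** The two inner loops are chained through [u1 n.+1 L + u2 n M]. Both energy drops are nonnegative
    with sum [D n], so each is at most [D n]. *)
Lemma outer_step n : split_iterate n ->
  [/\ split_iterate n.+1,
     [/\ c * `|u1 n.+1 L - u1 n L| ^+ 2 <= 2 ^+ L * D n &
         c * `|u1 n.+1 1%N - u1 n L| ^+ 2 <= D n] &
     [/\ c * `|u2 n.+1 M - u2 n M| ^+ 2 <= 2 ^+ M * D n &
         c * `|u2 n.+1 1%N - u2 n M| ^+ 2 <= D n]].
Proof.
move=> [Vu1 Vu2 uE pu].
have := inner_loop_descent psi_seminorm alpha_gt0 c_gt0 T_gap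
  (fun l lL => step1 u_alg n lL).
rewrite (start1 u_alg) -uE => /(_ Vu1 pu L (leqnn L))[Vu1' pmid d1 /(_ L_ge1) e1].
have := inner_loop_descent psi_seminorm alpha_gt0 c_gt0 T_gap
  (step2_surrogate1 n).
rewrite (start2 u_alg) (addrC (u2 n M)) => /(_ Vu2 pmid M (leqnn M))[].
move=> Vu2'; rewrite (addrC (u2 n.+1 M)) -(update u_alg) => pu' d2 /(_ M_ge1) e2.
have cge0 (x : H) : 0 <= c * `|x| ^+ 2 by rewrite mulr_ge0 ?sqr_ge0 // ltW.
have k1 k : 1 <= 2 ^+ k :> R by rewrite exprn_ege1 // ler1n.
have D1 := le_trans (cge0 _) e1; have D2 := le_trans (cge0 _) e2.
split; first by split => //; exact: update u_alg n.
- split; last by move: D1 D2 e1 e2; rewrite /D /F; lra.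
  by apply: (le_trans d1); rewrite ler_pM2l ?(lt_le_trans ltr01) // /D /F; lra.
- split; last by move: D1 D2 e1 e2; rewrite /D /F; lra.
  by apply: (le_trans d2); rewrite ler_pM2l ?(lt_le_trans ltr01) // /D /F; lra.
Qed.

Lemma split_iterateP n : split_iterate n.
Proof. by elim: n => [|n /outer_step[]//]; exact: split_iterate0. Qed.

Lemma energy_gap_ge0 n : 0 <= D n.
Proof.
have [_ [_ d] _] := outer_step (split_iterateP n).
by apply: le_trans d; rewrite mulr_ge0 ?sqr_ge0 // ltW.
Qed.

Lemma outer_gap n :
  c * `|u n.+1 - u n| ^+ 2 <= 2 * (2 ^+ L + 2 ^+ M) * D n.
Proof.
have [[_ _ uE' _] [d1 _] [d2 _]] := outer_step (split_iterateP n).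
have [_ _ uE _] := split_iterateP n.
rewrite uE uE' opprD addrACA.
apply: (@le_trans _ _ (2 * (c * `|u1 n.+1 L - u1 n L| ^+ 2) +
                       2 * (c * `|u2 n.+1 M - u2 n M| ^+ 2))); last lra.
rewrite -!(mulrCA c) -mulrDr ler_pM2l //.
exact: sqr_normD_le.
Qed.

Lemma real_energy_decreasing n : u n <> u n.+1 -> F (u n.+1) < F (u n).
Proof.
move=> uu; rewrite -subr_gt0.
have k0 : 0 < 2 * (2 ^+ L + 2 ^+ M) :> R.
  by rewrite mulr_gt0 // addr_gt0 // exprn_gt0.
rewrite -(pmulr_rgt0 _ k0); apply: lt_le_trans (outer_gap n).
by rewrite mulr_gt0 // exprn_gt0 // normr_gt0 subr_eq0 eq_sym; exact/eqP.
Qed.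

Lemma real_energy_nonincreasing n : F (u n) <= F (u 0%N).
Proof.
elim: n => // n; apply: le_trans; rewrite -subr_ge0; exact: energy_gap_ge0.
Qed.

Lemma energy_gap_cvg0 : D n @[n --> \oo] --> (0 : R).
Proof.
have Fc : cvgn (fun n => F (u n)).
  apply: nonincreasing_is_cvgn.
    by apply/nonincreasing_seqP => n; rewrite -subr_ge0; exact: energy_gap_ge0.
  by exists 0 => _ [n _ <-]; exact: real_energy_ge0.
rewrite -(subrr (limn (fun n => F (u n)))); apply: cvgB => //.
by have := Fc; rewrite -(cvg_shiftS (fun n => F (u n))).
Qed.

Lemma u_increment_cvg0 : u n.+1 - u n @[n --> \oo] --> (0 : H).
Proof. exact: cvg0_of_sqr_norm_le c_gt0 outer_gap energy_gap_cvg0. Qed.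

Lemma u1_increment_cvg0 : u1 n.+1 L - u1 n L @[n --> \oo] --> (0 : H).
Proof.
apply: cvg0_of_sqr_norm_le c_gt0 _ energy_gap_cvg0 => n.
by have [_ [d _] _] := outer_step (split_iterateP n); exact: d.
Qed.

Lemma u1_first_increment_cvg0 : u1 n.+1 1%N - u1 n L @[n --> \oo] --> (0 : H).
Proof.
apply: (cvg0_of_sqr_norm_le (K := 1)) c_gt0 _ energy_gap_cvg0 => n.
by have [_ [_ d] _] := outer_step (split_iterateP n); rewrite mul1r.
Qed.

Lemma u2_first_increment_cvg0 : u2 n.+1 1%N - u2 n M @[n --> \oo] --> (0 : H).
Proof.
apply: (cvg0_of_sqr_norm_le (K := 1)) c_gt0 _ energy_gap_cvg0 => n.
by have [_ _ [_ d]] := outer_step (split_iterateP n); rewrite mul1r.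
Qed.

End Algorithm.

(** * Optimality conditions for convex penalties *)

Section ConvexOptimality.
Context {R : realType} {H : completeNormedModType R} (ip : {dot H for idfun}).
Context (ipE : norm_of_dot ip).
Context (T : {linear H -> H}) (g : H) (alpha : R) (alpha_gt0 : 0 < alpha).
Context (p : H -> R).
Context (p_convex : forall t x y, 0 <= t <= 1 ->
  p ((1 - t) *: x + t *: y) <= (1 - t) * p x + t * p y).
Context (w : H).

Let F x := `|T x - g| ^+ 2 + 2 * alpha * p x.
(** Twice this is the change of [F] from [w] to [w + d] without its quadratic part |T d|^2. *)
Let slope d := ip (T w - g) (T d) + alpha * (p (w + d) - p w).

Lemma convex_segment t d : 0 <= t <= 1 ->
  p (w + t *: d) - p w <= t * (p (w + d) - p w).
Proof.
move=> t01; have := p_convex w (w + d) t01.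
rewrite scalerDr addrA -scalerDl subrK scale1r; lra.
Qed.

Lemma tikhonovD d : F (w + d) =
  F w + 2 * ip (T w - g) (T d) + `|T d| ^+ 2 + 2 * alpha * (p (w + d) - p w).
Proof.
rewrite /F linearD addrAC (sqr_normD ipE); ring.
Qed.

Lemma slope_ge0 (V : set H) :
  (forall a v, V v -> V (a *: v)) ->
  (forall v, V v -> F w <= F (w + v) + `|v| ^+ 2) ->
  forall v, V v -> 0 <= slope v.
Proof.
move=> VZ Fw v Vv; rewrite leNgt; apply/negP => S0.
pose S := slope v; pose Q := `|T v| ^+ 2 + `|v| ^+ 2.
have Q0 : 0 <= Q by rewrite addr_ge0 ?sqr_ge0.
have QS : 0 < Q - S by rewrite subr_gt0 (lt_le_trans S0).
(* For this [t] one has 2S + tQ = (1 + t)S < 0, against minimality in the direction [t *: v]; Q >= 0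
   keeps t <= 1, where convexity applies. *)
pose t := - S / (Q - S).
have tE : t * (Q - S) = - S by rewrite divfK // gt_eqF.
have t0 : 0 < t by rewrite divr_gt0 // oppr_gt0.
have t1 : t <= 1 by rewrite ler_pdivrMr // mul1r; lra.
have := Fw _ (VZ t v Vv); rewrite tikhonovD linearZ dotZr !sqr_normZ.
have : p (w + t *: v) - p w <= t * (p (w + v) - p w).
  by apply: convex_segment; rewrite ltW.
rewrite -(ler_pM2l alpha_gt0) => h1 h2.
have : 0 <= t * (2 * S + t * Q) by move: h1 h2; rewrite /S /slope /Q; lra.
rewrite pmulr_rge0 //; move: tE t0; rewrite mulrBr => tE t0.
have : t * S < 0 by rewrite pmulr_rlt0.
by move: S0; rewrite -/S; lra.
Qed.

Lemma minimizer_of_slope_ge0 : (forall d, 0 <= slope d) -> forall y, F w <= F y.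
Proof.
move=> s0 y; rewrite -(subrKC w y) tikhonovD.
by have := s0 (y - w); have := sqr_ge0 `|T (y - w)|; rewrite /slope; lra.
Qed.

(* [w + (x / 2) d2] is the midpoint of [w + x (d1 + d2)] and [w - x d1], so
   the one-sided derivative of [p] along [d2] is at most that along [d1 + d2]
   minus the derivative along [d1]. *)
Lemma slopeD_ge0 (V V' : set H) (d1 d2 : H) (z : R) :
  (forall a v, V v -> V (a *: v)) -> (forall a v, V' v -> V' (a *: v)) ->
  (forall v, V v -> 0 <= slope v) -> (forall v, V' v -> 0 <= slope v) ->
  V d1 -> V' d2 ->
  (p (w + t *: d1) - p w) / t @[t --> 0^'] --> z ->
  0 <= slope (d1 + d2).
Proof.
move=> VZ V'Z sV sV' Vd1 V'd2 pz.
(* Optimality along [d1] bounds the right derivative from below. *)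
have lb : - ip (T w - g) (T d1) / alpha <= z.
  apply: (cvgr_to_ge (cvg_dnbhs_at_right pz)).
  near=> t; have t0 : 0 < t by near: t; exact: nbhs_right_gt.
  rewrite ler_pdivrMr // mulrAC ler_pdivlMr //.
  by have := sV _ (VZ t _ Vd1); rewrite /slope linearZ dotZr; lra.
(* The midpoint inequality bounds the left derivative from above, with x = -s in (0, 1). As both
   one-sided limits equal [z], the bounds combine into the claim. *)
have ub : z <= (slope (d1 + d2) - ip (T w - g) (T d1)) / alpha.
  apply: (cvgr_to_le (cvg_dnbhs_at_left pz)).
  near=> s; have s0 : s < 0 by near: s; exact: nbhs_left_lt.
  have s1 : - 1 < s by near: s; apply: nbhs_left_gt; rewrite oppr_lt0.
  rewrite ler_ndivrMr // mulrAC ler_pdivrMr //.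
  pose x := - s.
  have h1 := sV' _ (V'Z (x / 2) _ V'd2).
  have h2 : p (w + (x / 2) *: d2) <=
      2^-1 * p (w + x *: (d1 + d2)) + 2^-1 * p (w + s *: d1).
    have := @p_convex 2^-1 (w + x *: (d1 + d2)) (w + s *: d1).
    rewrite invr_ge0 ler0n invf_le1 // ler1n => /(_ isT).
    rewrite (_ : 1 - 2^-1 = 2^-1); last by field.
    rewrite -scalerDr (_ : w + _ + _ = w + w + x *: d2); last first.
      by rewrite addrACA scalerDr (addrAC (_ *: d1)) -scalerDl addNr scale0r add0r.
    rewrite (_ : 2^-1 *: _ = w + (x / 2) *: d2) //.
    by rewrite scalerDr scalerA (mulrC _ x) scalerDr -scalerDl -div1r -splitr scale1r.
  have h3 : p (w + x *: (d1 + d2)) - p w <= x * (p (w + (d1 + d2)) - p w).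
    by apply: convex_segment; rewrite /x; lra.
  move: (ler_wpM2l (ltW alpha_gt0) h2) (ler_wpM2l (ltW alpha_gt0) h3) h1.
  rewrite /slope [T (d1 + d2)]linearD [T (_ *: d2)]linearZ dotDr dotZr.
  rewrite /x; lra.
move: (le_trans lb ub); rewrite ler_pM2r ?invr_gt0 //; lra.
Unshelve. all: by end_near. Qed.

End ConvexOptimality.

(** * Continuity of the penalty in finite dimension and passage to the limit along subsequences *)

Lemma increasing_seq_cvg_infty (phi : nat -> nat) : increasing_seq phi ->
  phi n @[n --> \oo] --> \oo.
Proof.
move=> phi_incr A [N _ NA]; exists N => // n /= Nn; apply: NA => /=.
apply: leq_trans Nn _; elim: n => // n; move=> /leq_ltn_trans; apply.
by move/increasing_seqP : phi_incr; apply.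
Qed.

Section SeminormFine.
Context {R : realType} {H : completeNormedModType R}.
Context (psi : H -> \bar R) (psi_seminorm : extended_seminorm psi).

Lemma fine_psi0 : fine (psi 0) = 0.
Proof. by case: psi_seminorm => _ ->. Qed.

Lemma Hpsi0 : Hpsi psi 0.
Proof. by case: psi_seminorm => _ p0 _ _; rewrite /Hpsi /= p0. Qed.

Lemma fine_psiD u v : Hpsi psi u -> Hpsi psi v ->
  fine (psi (u + v)) <= fine (psi u) + fine (psi v).
Proof.
move=> pu pv; have puv := HpsiD psi_seminorm pu pv.
have [fu fv] := (Hpsi_fin_num psi_seminorm pu, Hpsi_fin_num psi_seminorm pv).
rewrite -fineD // fine_le ?fin_numD ?fu //; first exact: Hpsi_fin_num.
by case: psi_seminorm.
Qed.

Lemma fine_psiZ a u : Hpsi psi u -> fine (psi (a *: u)) = `|a| * fine (psi u).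
Proof.
by move=> pu; case: psi_seminorm => _ _ _ ->; rewrite fineM // Hpsi_fin_num.
Qed.

(** Expand [u] in a basis taken from [Hpsi psi] and use subadditivity and homogeneity;
    Cauchy-Schwarz bounds the coefficients by |e_i| |u|. *)
Lemma finite_dimensional_psi (ip : {dot H for idfun}) :
  norm_of_dot ip -> finite_dimensional H -> dense (Hpsi psi) ->
  (forall u, Hpsi psi u) /\
  exists K, forall u, fine (psi u) <= K * `|u|.
Proof.
move=> ipE Hfin Hdense.
have [|a x y px py|k [e [eH xE]]] := @dense_subspace_orthonormal_basis _ _ ip ipE
  (Hpsi psi) Hfin _ _ Hdense.
- exact: Hpsi0.
- by apply: HpsiD => //; exact: HpsiZ.
have psum x : Hpsi psi (\sum_(i < k) ip x (e i) *: e i) /\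
    fine (psi (\sum_(i < k) ip x (e i) *: e i)) <=
    \sum_(i < k) `|e i| * fine (psi (e i)) * `|x|.
  apply: (big_ind2 (fun y r => Hpsi psi y /\ fine (psi y) <= r)) =>
    [|x1 y1 x2 y2 [p1 le1] [p2 le2]|i _].
  - by rewrite fine_psi0; split => //; exact: Hpsi0.
  - split; first exact: HpsiD.
    by apply: (le_trans (fine_psiD p1 p2)); exact: lerD.
  - split; first by apply: HpsiZ => //; exact: eH.
    rewrite (fine_psiZ _ (eH _ (ltn_ord i))) mulrAC ler_wpM2r ?fine_ge0 //.
      by case: psi_seminorm.
    by rewrite mulrC; exact: dot_le.
split=> [x|]; first by rewrite [x]xE; exact: (psum x).1.
exists (\sum_(i < k) `|e i| * fine (psi (e i))) => x.
by rewrite {1}[x]xE mulr_suml; exact: (psum x).2.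
Qed.

Context (psi_fin : forall u, Hpsi psi u).

Lemma fine_psi_convex (t : R) x y : 0 <= t <= 1 ->
  fine (psi ((1 - t) *: x + t *: y)) <=
  (1 - t) * fine (psi x) + t * fine (psi y).
Proof.
move=> /andP[t0 t1]; apply: (le_trans (fine_psiD (psi_fin _) (psi_fin _))).
by rewrite !fine_psiZ // !ger0_norm ?subr_ge0.
Qed.

(** The reverse triangle inequality makes the seminorm Lipschitz; the constant |K| + 1 is positive
    whatever [K] is. *)
Lemma continuous_fine_psi (K : R) : (forall u, fine (psi u) <= K * `|u|) ->
  continuous (fun u => fine (psi u)).
Proof.
move=> psiK x; apply/cvgrPdist_le => e e0.
have K0 : 0 < `|K| + 1 by rewrite ltr_wpDl.
have tri (a b : H) : fine (psi a) - fine (psi b) <= (`|K| + 1) * `|a - b|.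
  have := fine_psiD (psi_fin (a - b)) (psi_fin b); rewrite subrK => h.
  have : K * `|a - b| <= (`|K| + 1) * `|a - b|.
    by rewrite ler_wpM2r // (le_trans (ler_norm K)) // lerDl.
  by have := psiK (a - b); lra.
have /cvgrPdist_le/(_ (e / (`|K| + 1))) := @cvg_id _ (nbhs x).
rewrite divr_gt0 // => /(_ isT); apply: filterS => y.
rewrite ler_pdivlMr // mulrC => xy; rewrite ler_norml.
have := tri x y; have := tri y x; rewrite (distrC y x); lra.
Qed.

End SeminormFine.

(** Old and new iterates share the limit [A], so the surrogate term on the left vanishes; on the
    right the term -|T(v - A)|^2 is dropped. *)
Lemma surrogate_limit {R : realType} {H : completeNormedModType R}
    (F : H -> R) (T : {linear H -> H}) (a a' b : nat -> H) (A B v : H) :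
  continuous F -> continuous T ->
  a n @[n --> \oo] --> A -> a' n @[n --> \oo] --> A ->
  b n @[n --> \oo] --> B ->
  (forall n, F (a' n + b n) + (`|a' n - a n| ^+ 2 - `|T (a' n - a n)| ^+ 2) <=
    F (v + b n) + (`|v - a n| ^+ 2 - `|T (v - a n)| ^+ 2)) ->
  F (A + B) <= F (v + B) + `|v - A| ^+ 2.
Proof.
move=> Fc Tc aA a'A bB h.
have qc (x : nat -> H) y : x n @[n --> \oo] --> y ->
    `|x n| ^+ 2 - `|T (x n)| ^+ 2 @[n --> \oo] --> `|y| ^+ 2 - `|T y| ^+ 2.
  move=> xy; apply: cvgB.
    by apply: (cvgM (cvg_norm xy) (cvg_norm xy)).
  have Txy := cvg_comp _ _ xy (Tc y).
  by apply: (cvgM (cvg_norm Txy) (cvg_norm Txy)).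
have Fc' (x y : nat -> H) X Y : x n @[n --> \oo] --> X ->
    y n @[n --> \oo] --> Y -> F (x n + y n) @[n --> \oo] --> F (X + Y).
  by move=> xX yY; apply: (cvg_comp _ _ (cvgD xX yY) (Fc _)).
have l1 : F (a' n + b n) + (`|a' n - a n| ^+ 2 - `|T (a' n - a n)| ^+ 2)
    @[n --> \oo] --> F (A + B) + (`|A - A| ^+ 2 - `|T (A - A)| ^+ 2).
  by apply: cvgD; [exact: Fc'|apply: qc; exact: cvgB].
have l2 : F (v + b n) + (`|v - a n| ^+ 2 - `|T (v - a n)| ^+ 2)
    @[n --> \oo] --> F (v + B) + (`|v - A| ^+ 2 - `|T (v - A)| ^+ 2).
  apply: cvgD; first by apply: Fc' => //; exact: cvg_cst.
  by apply: qc; apply: cvgB => //; exact: cvg_cst.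
apply: le_trans (_ : F (A + B) <= F (v + B) + (`|v - A| ^+ 2 - `|T (v - A)| ^+ 2)) _.
  have := ler_cvg_to l1 l2 (nearW _ h).
  by rewrite subrr linear0 normr0 subrr addr0; apply.
by rewrite lerD2l gerBl sqr_ge0.
Qed.

Lemma closed_subspace0 {R : realType} {H : completeNormedModType R}
    (V : set H) : closed_subspace V -> V 0.
Proof. by move=> [[/set_mem V0 _] _]. Qed.

Lemma closed_subspaceP {R : realType} {H : completeNormedModType R}
    (V : set H) (a : R) (x y : H) :
  closed_subspace V -> V x -> V y -> V (a *: x + y).
Proof.
by move=> [[_ VP] _] Vx Vy; apply: set_mem; apply: VP; exact: mem_set.
Qed.

Lemma closed_subspaceZ {R : realType} {H : completeNormedModType R}
    (V : set H) (a : R) (x : H) : closed_subspace V -> V x -> V (a *: x).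
Proof.
move=> Vc Vx; rewrite -[_ *: _]addr0.
exact: closed_subspaceP Vc Vx (closed_subspace0 Vc).
Qed.

Lemma closed_subspaceD {R : realType} {H : completeNormedModType R}
    (V : set H) (x y : H) : closed_subspace V -> V x -> V y -> V (x + y).
Proof. by move=> Vc Vx Vy; rewrite -[x]scale1r; exact: closed_subspaceP. Qed.

(** By Pythagoras the error of one component is at most the error of the sum. *)
Lemma cvg_orth_component {R : realType} {H : completeNormedModType R}
    (ip : {dot H for idfun}) (a b : nat -> H) (A B : H) :
  norm_of_dot ip -> (forall n, ip (a n - A) (b n - B) = 0) ->
  a n + b n @[n --> \oo] --> A + B -> a n @[n --> \oo] --> A.
Proof.
move=> ipE ab0 /cvgrPdist_le abc; apply/cvgrPdist_le => e e0.
apply: filterS (abc e e0) => n; apply: le_trans.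
rewrite (distrC A) (distrC (A + B)) -ler_sqr ?nnegrE //.
by rewrite opprD addrACA [leRHS](sqr_normD ipE) ab0 mulr0 addr0 lerDl sqr_ge0.
Qed.

(** * Descent, convergent subsequences and minimality of limit points *)

Theorem theorem5p1 (R : realType) (H : completeNormedModType R)
  (ip : {dot H for idfun}) (ipE : norm_of_dot ip) (sepH : separable H)
  (psi : H -> \bar R)
  (psi_seminorm : extended_seminorm psi)
  (psi_lsc : lower_semicontinuous psi)
  (Hpsi_dense : dense (Hpsi psi))
  (Hpsi_banach : Hpsi_complete psi)
  (tau : Topological.axioms_ (Hpsi_type psi))
  (tau_compact : tau_sequentially_compact tau)
  (tau_lsc : tau_sequentially_lsc tau)
  (V1 V2 : set H)
  (V1_closed : closed_subspace V1) (V2_closed : closed_subspace V2)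
  (V12_orth : orthogonal_subspaces ip V1 V2)
  (V12_sum : spanned_by_sum V1 V2)
  (V1_proj : compatible_projection psi ip V1)
  (V2_proj : compatible_projection psi ip V2)
  (T : {linear H -> H}) (T_bounded : bounded_fun_norm T)
  (T_lt1 : opnorm T < 1)
  (g : H) (alpha : R) (alpha_gt0 : 0 < alpha)
  (J_coercive : coercive psi T g alpha)
  (L M : nat) (L_ge1 : (1 <= L)%N) (M_ge1 : (1 <= M)%N)
  (u0 : H) (u0_Hpsi : Hpsi psi u0)
  (u : nat -> H) (u1 u2 : nat -> nat -> H)
  (u_alg : sequential_algorithm psi T g alpha ip V1 V2 L M u0 u u1 u2) :
  let J := energy psi T g alpha in
  (forall n, Hpsi psi (u n)) /\
  [/\ forall n, u n <> u n.+1 -> (J (u n.+1) < J (u n))%E,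
      `|u n.+1 - u n| @[n --> \oo] --> (0 : R),
      exists2 phi : nat -> nat, increasing_seq phi &
        (exists w, weak_cvg (u \o phi) w) /\
        (exists (v : nat -> Hpsi_type psi) (w : Hpsi_type psi),
          (forall k, \val (v k) = u (phi k)) /\ tau_cvg tau v w) &
      finite_dimensional H ->
      forall (phi : nat -> nat) (uinf : H), increasing_seq phi ->
        u (phi k) @[k --> \oo] --> uinf ->
        let uinf1 := orth_proj ip V1 uinf in
        let uinf2 := orth_proj ip V2 uinf in
        (splitting_condition psi V1 V2 uinf1 uinf2 \/
         (differentiable_wrt psi V1 (uinf1 + uinf2) \/
          differentiable_wrt psi V2 (uinf1 + uinf2))) ->
        argmin setT J uinf].
Proof.
move=> J.
have [c c0 T_gap] := contraction_gap T_bounded T_lt1.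
have Tc := continuous_bounded_operator T_bounded.
have split := split_iterateP ipE psi_seminorm V12_orth V12_sum alpha_gt0 c0
  T_gap L_ge1 M_ge1 u0_Hpsi u_alg.
have u_Hpsi n : Hpsi psi (u n) by have [] := split n.
pose F := real_energy psi T g alpha.
have JE n : J (u n) = (F (u n))%:E by rewrite /J energyE.
have F_noninc n : F (u n) <= F (u 0%N).
  exact: (real_energy_nonincreasing ipE psi_seminorm V12_orth V12_sum alpha_gt0
    c0 T_gap L_ge1 M_ge1 u0_Hpsi u_alg).
split=> //; split.
- move=> n uu; rewrite !JE lte_fin.
  exact: (real_energy_decreasing ipE psi_seminorm V12_orth V12_sum alpha_gt0
    c0 T_gap L_ge1 M_ge1 u0_Hpsi u_alg).
- apply/norm_cvg0P.
  exact: (u_increment_cvg0 ipE psi_seminorm V12_orth V12_sum alpha_gt0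
    c0 T_gap L_ge1 M_ge1 u0_Hpsi u_alg).
- have [C uC] : exists C, forall n, `|u n| <= C.
    have [C [_ JC]] := J_coercive (F (u 0%N)).
    exists (C + 1) => n; apply: (JC (C + 1)); first by rewrite ltrDl.
    by rewrite /= -/(J (u n)) JE lee_fin.
  have a0 : 0 < 2 * alpha by rewrite mulr_gt0.
  have psiC n : fine (psi (u n)) <= F (u 0%N) / (2 * alpha).
    rewrite ler_pdivlMr // mulrC; apply: le_trans (F_noninc n).
    by rewrite /F /real_energy lerDr sqr_ge0.
  pose v n : Hpsi_type psi := exist _ (u n) (u_Hpsi n).
  (* The weakly convergent subsequence is extracted from the tau-convergent one, so that a single
     [phi] serves both topologies. *)
  have [|phi1 phi1_incr [w vw]] := tau_compact v.
    by exists (C + F (u 0%N) / (2 * alpha)) => n; apply: lerD; [exact: uC|exact: psiC].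
  have [|phi2 phi2_incr [x ux]] := weakly_convergent_subsequence ipE
    (x := u \o phi1) (C := C) sepH; first by move=> n; exact: uC.
  exists (phi1 \o phi2); first by move=> m n; rewrite /= phi1_incr -leEnat phi2_incr.
  split; first by exists x.
  exists (v \o phi1 \o phi2), w; split=> //.
  exact: cvg_comp (increasing_seq_cvg_infty phi2_incr) vw.
move=> Hfin phi uinf phi_incr.
have [psi_fin [K psiK]] := finite_dimensional_psi psi_seminorm ipE Hfin Hpsi_dense.
pose p x := fine (psi x).
have psiE : psi = fun x => (p x)%:E.
  by apply/funext => x; rewrite /p fineK // Hpsi_fin_num.
have [w1 [w2 [Vw1 Vw2 ->]]] := V12_sum uinf => u_cvg w1' w2'.
rewrite {}/w1' {}/w2' (orth_projDl ipE V12_orth) // (orth_projDr ipE V12_orth) // => cond.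
have FJ x : J x = (F x)%:E by rewrite /J energyE.
have Fc : continuous F.
  have pc := continuous_fine_psi psi_seminorm psi_fin psiK.
  move=> x; apply: cvgD; last by apply: cvgM; [exact: cvg_cst|exact: pc].
  have Tg : T y - g @[y --> x] --> T x - g.
    by apply: cvgB; [exact: Tc|exact: cvg_cst].
  exact: cvgM (cvg_norm Tg) (cvg_norm Tg).
have sub (x : nat -> H) (l : H) : x n @[n --> \oo] --> l -> x (phi k) @[k --> \oo] --> l.
  exact: cvg_comp (increasing_seq_cvg_infty phi_incr).
have dot0 k : ip (u1 (phi k) L - w1) (u2 (phi k) M - w2) = 0.
  have [Vu1 Vu2 _ _] := split (phi k).
  by rewrite !(dotDl, dotNl) !(dotDr, dotNr) !V12_orth // !(oppr0, addr0).
have u12_cvg : u1 (phi k) L + u2 (phi k) M @[k --> \oo] --> w1 + w2.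
  rewrite (_ : (fun k => _) = fun k => u (phi k)) //.
  by apply/funext => k; have [_ _ ->] := split (phi k).
have a1 : u1 (phi k) L @[k --> \oo] --> w1 by apply: cvg_orth_component u12_cvg.
have a2 : u2 (phi k) M @[k --> \oo] --> w2.
  apply: (@cvg_orth_component _ _ ip _ (fun k => u1 (phi k) L) _ w1) => //.
    by move=> k; rewrite dotC.
  by rewrite addrC; under eq_fun do rewrite addrC.
have shift (x y : nat -> H) (l : H) : x n - y n @[n --> \oo] --> (0 : H) ->
    y (phi k) @[k --> \oo] --> l -> x (phi k) @[k --> \oo] --> l.
  move=> xy yl; rewrite -[l]add0r.
  rewrite (_ : (fun k => _) = fun k => x (phi k) - y (phi k) + y (phi k)).
    by apply: cvgD => //; exact: (sub (fun n => x n - y n)).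
  by apply/funext => k; rewrite subrK.
(* The second loop runs against the updated first component, which still tends to [w1] because its
   increments vanish. *)
have b1 : u1 (phi k).+1 L @[k --> \oo] --> w1.
  apply: (shift (fun n => u1 n.+1 L) (fun n => u1 n L)) a1.
  exact: (u1_increment_cvg0 ipE psi_seminorm V12_orth V12_sum
    alpha_gt0 c0 T_gap L_ge1 M_ge1 u0_Hpsi u_alg).
have a1' : u1 (phi k).+1 1%N @[k --> \oo] --> w1.
  apply: (shift (fun n => u1 n.+1 1%N) (fun n => u1 n L)) a1.
  exact: (u1_first_increment_cvg0 ipE psi_seminorm V12_orth
    V12_sum alpha_gt0 c0 T_gap L_ge1 M_ge1 u0_Hpsi u_alg).
have a2' : u2 (phi k).+1 1%N @[k --> \oo] --> w2.
  apply: (shift (fun n => u2 n.+1 1%N) (fun n => u2 n M)) a2.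
  exact: (u2_first_increment_cvg0 ipE psi_seminorm V12_orth
    V12_sum alpha_gt0 c0 T_gap L_ge1 M_ge1 u0_Hpsi u_alg).
(* The first inner step from [u1 (phi k) L] is compared with [v + w1], whose distance to the limit
   [w1] is |v|. *)
have opt1 v : V1 v -> F (w1 + w2) <= F (w1 + w2 + v) + `|v| ^+ 2.
  move=> Vv; have Vv' := closed_subspaceD V1_closed Vv Vw1.
  have := surrogate_limit Fc Tc a1 a1' a2 (v := v + w1).
  rewrite addrK (addrC _ v) addrA; apply=> k.
  have [Vu1 _ _ _] := split (phi k).
  have := step1 u_alg (phi k) L_ge1; rewrite (start1 u_alg) => amin.
  by have [_ _] := surrogate_argmin psi_seminorm alpha_gt0 amin Vu1 (psi_fin _);
    apply.
have opt2 v : V2 v -> F (w1 + w2) <= F (w1 + w2 + v) + `|v| ^+ 2.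
  move=> Vv; have Vv' := closed_subspaceD V2_closed Vv Vw2.
  have := surrogate_limit Fc Tc a2 a2' b1 (v := v + w2).
  rewrite addrK (addrC _ v) (addrC w1) addrA; apply=> k.
  have [_ Vu2 _ _] := split (phi k).
  have := step2_surrogate1 u_alg (phi k) M_ge1; rewrite (start2 u_alg) => amin.
  by have [_ _] := surrogate_argmin psi_seminorm alpha_gt0 amin Vu2 (psi_fin _);
    apply.
have pconv : forall t x y, 0 <= t <= 1 ->
    p ((1 - t) *: x + t *: y) <= (1 - t) * p x + t * p y.
  exact: fine_psi_convex psi_seminorm psi_fin.
have V1Z a v : V1 v -> V1 (a *: v) by exact: closed_subspaceZ.
have V2Z a v : V2 v -> V2 (a *: v) by exact: closed_subspaceZ.
have s1 v : V1 v -> 0 <= ip (T (w1 + w2) - g) (T v) +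
    alpha * (p (w1 + w2 + v) - p (w1 + w2)).
  exact: (slope_ge0 ipE alpha_gt0 pconv V1Z opt1).
have s2 v : V2 v -> 0 <= ip (T (w1 + w2) - g) (T v) +
    alpha * (p (w1 + w2 + v) - p (w1 + w2)).
  exact: (slope_ge0 ipE alpha_gt0 pconv V2Z opt2).
split=> // y _; rewrite !FJ lee_fin; move: y.
apply: (minimizer_of_slope_ge0 (p := p) ipE) => d.
have [d1 [d2 [Vd1 Vd2 ->]]] := V12_sum d.
have diffE V : differentiable_wrt psi V (w1 + w2) -> forall v, V v ->
    exists z : R, (p (w1 + w2 + t *: v) - p (w1 + w2)) / t @[t --> 0^'] --> z.
  move=> [z _ zE] v /zE; rewrite [in X in X -> _]psiE => /fine_cvg; by exists (z v).
case: cond => [ab|[diff1|diff2]].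
- have h : p (w1 + w2 + d2) + p (w1 + w2 + d1) - p (w1 + w2) <=
      p (w1 + w2 + (d1 + d2)).
    (* Shifting the test vectors by [w1] and [w2] turns (a) into superadditivity of the increments
       of [p] at [w1 + w2], so the two variational inequalities add up. *)
    have := ab (w1 + d1) (w2 + d2) (closed_subspaceD V1_closed Vw1 Vd1)
      (closed_subspaceD V2_closed Vw2 Vd2).
    by rewrite addrACA (addrA w1) (addrCA w2) (addrA w1) psiE -lee_fin.
  have := ler_wpM2l (ltW alpha_gt0) h; have := s1 d1 Vd1; have := s2 d2 Vd2.
  by rewrite [T (d1 + d2)]linearD dotDr; lra.
- have [z zE] := diffE _ diff1 d1 Vd1.
  exact: (slopeD_ge0 alpha_gt0 pconv V1Z V2Z s1 s2 Vd1 Vd2 zE).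
- have [z zE] := diffE _ diff2 d2 Vd2; rewrite [d1 + d2]addrC.
  exact: (slopeD_ge0 alpha_gt0 pconv V2Z V1Z s2 s1 Vd2 Vd1 zE).
Qed.
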